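(* Let $d=(d_1,\dots,d_n)$ be a graphic list with $d_1\ge\dots\ge d_n$, and let $i,j$ be integers with $1\le i<j\le n$. The pair $\{i,j\}$ is a forced edge for $d$ if and only if there exists $k$ with $1\le k\le n$ such that one of the following holds: (1) $\Delta_k(d)\le 1$ and $j\le k$; (2) $\Delta_k(d)=0$, $i\le k<j$, and $k\le d_j$. The pair $\{i,j\}$ is a forced non-edge for $d$ if and only if there exists $k$ with $1\le k\le n$ such that one of the following holds: (3) $\Delta_k(d)\le 1$ and $d_i<k<i$; (4) $\Delta_k(d)=0$, $k<i$, and $d_j\le k\le d_i$.
   Context: All graphs are finite and simple; a list is graphic if it is the degree sequence of some graph. Realizations of $d$ are labeled graphs on vertex set $[n]$ in which vertex $\ell$ has degree $d_\ell$. A pair $\{i,j\}$ is a forced edge (resp. forced non-edge) for $d$ if $i,j$ are adjacent in every (resp. in no) realization of $d$. For an integer sequence $\pi=(\pi_1,\dots,\pi_n)$ and $k\in[n]$, define $\operatorname{LHS}_k(\pi)=\sum_{\ell\le k}\pi_\ell$, $\operatorname{RHS}_k(\pi)=k(k-1)+\sum_{\ell>k}\min\{k,\pi_\ell\}$, and the $k$th Erdős–Gallai difference $\Delta_k(\pi)=\operatorname{RHS}_k(\pi)-\operatorname{LHS}_k(\pi)$.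
   Formalization: In the forced non-edge half, k ranges over 0 ≤ k ≤ n instead of 1 ≤ k ≤ n, and (3) reads d_i ≤ k < i instead of d_i < k < i; as printed it fails for d=(0,0), {1,2} and for d=(4,2,2,2,1,1), {5,6}. *)

(* Defs.v *)
From mathcomp Require Import all_boot all_order all_algebra.

Set Implicit Arguments.
Unset Strict Implicit.
Unset Printing Implicit Defensive.

(* Vertex l of [n] = {1, ..., n} is the ordinal of value l - 1 in 'I_n, so an
   ordinal x carries the 1-based position x.+1. *)

Definition simple_graph (T : finType) (e : rel T) : Prop :=
  symmetric e /\ irreflexive e.

Definition degree (T : finType) (e : rel T) (x : T) : nat := #|[set y | e x y]|.

Definition realization (n : nat) (d : n.-tuple nat) (e : rel 'I_n) : Prop :=
  simple_graph e /\ forall x : 'I_n, degree e x = tnth d x.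

Definition graphic (n : nat) (d : n.-tuple nat) : Prop :=
  exists e : rel 'I_n, realization d e.

Definition forced_edge (n : nat) (d : n.-tuple nat) (i j : 'I_n) : Prop :=
  forall e : rel 'I_n, realization d e -> e i j.

Definition forced_nonedge (n : nat) (d : n.-tuple nat) (i j : 'I_n) : Prop :=
  forall e : rel 'I_n, realization d e -> ~~ e i j.

Definition EG_LHS (n : nat) (d : n.-tuple nat) (k : nat) : nat :=
  \sum_(l < n | l.+1 <= k) tnth d l.

Definition EG_RHS (n : nat) (d : n.-tuple nat) (k : nat) : nat :=
  k * (k - 1) + \sum_(l < n | k < l.+1) minn k (tnth d l).

(* Valued in int, since it may be negative for a non-graphic list. At k = 0
   both sides are empty sums, so the difference is 0. *)
Definition EG_diff (n : nat) (d : n.-tuple nat) (k : nat) : int :=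
  ((EG_RHS d k)%:Z - (EG_LHS d k)%:Z)%R.

(* Main.v *)
(* For disjoint vertex sets S, T, let gap d S T = |S|(n - 1 - |T|) + sum_T d - sum_S d;
   minimizing over T for a given S of size k, and taking for S the first k
   vertices, gives Delta_k(d).  By the Erdos-Gallai theorem (in a form that ignores
   the order of the degrees), d is graphic iff its sum is even and all
   gaps are nonnegative.  Two counting inequalities show that {i,j} is not forced as
   soon as d and d + e_i + e_j are both graphic, so {i,j} is forced iff adding
   e_i + e_j makes some gap negative, i.e. iff for some S, T either i, j are in S and
   the gap is at most 1, or one of them is in S, the other outside of S and T, and
   the gap is 0.  Complementation exchanges S and T and gives the non-edge version.
   Finally (S, T) is moved step by step, without increasing the gap, until S can be
   replaced by an initial segment: this uses that the marginal cost of adding a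
   vertex to S, or to T, depends only on its degree and on |T|, or |S|. *)

Require Import Defs.
From mathcomp Require Import all_boot all_order all_algebra.
From mathcomp Require Import zify ring.

Set Implicit Arguments.
Unset Strict Implicit.
Unset Printing Implicit Defensive.

Import Order.TTheory GRing.Theory Num.Theory.

(* The cardinal of a set is elaborated to several convertible terms,
   with or without [reverse_coercion], which [lia] takes for distinct atoms. *)
Ltac lia_card := cbv beta delta [reverse_coercion] in *; lia.

(** * Edge edits and degree-preserving switches *)

Definition realizes (V : finType) (e : rel V) (d : V -> nat) : Prop :=
  simple_graph e /\ forall x, degree e x = d x.

Definition add_edge (V : finType) (e : rel V) (a b : V) : rel V :=
  fun x y => [|| e x y, (x == a) && (y == b) | (x == b) && (y == a)].

Definition del_edge (V : finType) (e : rel V) (a b : V) : rel V :=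
  fun x y => [&& e x y, ~~ ((x == a) && (y == b)) & ~~ ((x == b) && (y == a))].

Definition compl_graph (V : finType) (e : rel V) : rel V :=
  fun x y => (x != y) && ~~ e x y.

Definition switch (V : finType) (e : rel V) (a b c f : V) : rel V :=
  add_edge (add_edge (del_edge (del_edge e a b) c f) a c) b f.

Section GraphEdits.
Variables (V : finType) (e : rel V).
Hypothesis (eG : simple_graph e).
Implicit Types a b c f x y : V.

Lemma add_edge_simple a b : a != b -> simple_graph (add_edge e a b).
Proof.
case: eG => es ei ab; split=> [x y|x]; rewrite /add_edge.
  by rewrite es [(x == a) && _]andbC [(x == b) && _]andbC; congr (_ || _); rewrite orbC.
rewrite ei /=; apply/negP => /orP[] /andP[/eqP-> /eqP H]; move: ab; rewrite H eqxx //.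
Qed.

Lemma del_edge_simple a b : simple_graph (del_edge e a b).
Proof.
case: eG => es ei; split=> [x y|x]; rewrite /del_edge; last by rewrite ei.
by rewrite es [(x == a) && _]andbC [(x == b) && _]andbC; congr (_ && _); rewrite andbC.
Qed.

Lemma degree_add_edge a b x : a != b -> ~~ e a b ->
  degree (add_edge e a b) x = degree e x + ((x == a) + (x == b)).
Proof.
case: eG => es ei ab nab; rewrite /degree /add_edge.
have [->|xa] := eqVneq x a.
  rewrite (negbTE ab) /=.
  have -> : [set y | [|| e a y, y == b | false]] = b |: [set y | e a y].
    by apply/setP=> y; rewrite !inE orbF orbC.
  by rewrite cardsU1 inE nab; lia.
have [->|xb] := eqVneq x b.
  have -> : [set y | [|| e b y, false | (y == a)]] = a |: [set y | e b y].
    by apply/setP=> y; rewrite !inE /= orbC.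
  by rewrite cardsU1 inE es nab; lia.
by rewrite addn0; apply: eq_card => y; rewrite !inE !orbF.
Qed.

Lemma degree_del_edge a b x : a != b -> e a b ->
  degree e x = degree (del_edge e a b) x + ((x == a) + (x == b)).
Proof.
case: eG => es ei ab eab; rewrite /degree /del_edge.
have [->|xa] := eqVneq x a.
  rewrite (negbTE ab) /= (cardsD1 b [set y | e a y]) inE eab addnC.
  by congr (_ + _); apply: eq_card => y; rewrite !inE andbT andbC.
have [->|xb] := eqVneq x b.
  rewrite (cardsD1 a [set y | e b y]) inE es eab addnC.
  by congr (_ + _); apply: eq_card => y; rewrite !inE /= andbC.
by rewrite addn0; apply: eq_card => y; rewrite !inE !andbT.
Qed.

End GraphEdits.

Lemma edge_neq (V : finType) (e : rel V) (a b : V) :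
  simple_graph e -> e a b -> a != b.
Proof. by case=> _ ei eab; apply: contraTneq eab => ->; rewrite ei. Qed.

(** Each of [a], [b], [c], [f] trades one edge for another. The remaining inequalities among them
    come from the non-edge [ac]: [a = f] or [b = c] would turn it into an edge. *)
Lemma switch_realizes (V : finType) (e : rel V) (d : V -> nat) (a b c f : V) :
  realizes e d -> e a b -> e c f -> ~~ e a c -> ~~ e b f -> a != c -> b != f ->
  realizes (switch e a b c f) d.
Proof.
move=> [eG ed] eab ecf nac nbf ac bf.
have ab := edge_neq eG eab; have cf := edge_neq eG ecf.
have [es ei] := eG.
have af : a != f by apply: contraNneq nac => ->; rewrite es.
have bc : b != c by apply: contraNneq nac => <-.
pose e1 := del_edge e a b; pose e2 := del_edge e1 c f; pose e3 := add_edge e2 a c.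
have e1G : simple_graph e1 by apply: del_edge_simple.
have e2G : simple_graph e2 by apply: del_edge_simple.
have e3G : simple_graph e3 by apply: add_edge_simple.
have e1cf : e1 c f.
  by rewrite /e1 /del_edge ecf /= [c == a]eq_sym (negbTE ac) [c == b]eq_sym (negbTE bc).
have e2ac : ~~ e2 a c by rewrite /e2 /e1 /del_edge (negbTE nac).
have e3bf : ~~ e3 b f.
  rewrite /e3 /e2 /e1 /add_edge /del_edge (negbTE nbf) /= [b == a]eq_sym (negbTE ab).
  by rewrite (negbTE bc).
split; first exact: add_edge_simple.
move=> x; rewrite -ed /switch -/e1 -/e2 -/e3.
rewrite (degree_add_edge e3G) // (degree_add_edge e2G) //.
rewrite (degree_del_edge eG x ab eab) -/e1 (degree_del_edge e1G x cf e1cf) -/e2.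
ring.
Qed.

Lemma switch_removes (V : finType) (e : rel V) (a b c f : V) :
  a != b -> b != c -> a != f -> ~~ switch e a b c f a b.
Proof.
move=> ab bc af; rewrite /switch /add_edge /del_edge !eqxx [b == a]eq_sym.
by rewrite (negbTE ab) (negbTE bc) (negbTE af) !andbF.
Qed.

Lemma switch_adds (V : finType) (e : rel V) (a b c f : V) : switch e a b c f a c.
Proof. by rewrite /switch /add_edge !eqxx /= !orbT. Qed.

(* Take u in N_H(i) \ N_G(i). If no switch produces the required graph, then
   N_G(u) \ {j} is contained in N_G(j) \ {i, u}, and N_H(u) \ {j} contains
   i and N_H(j) \ {u}; so deg u < deg_G j < deg_H j < deg u. *)
Lemma avoiding_realization (V : finType) (eG eH : rel V) (d d' : V -> nat) (i j : V) :
  i != j -> (forall x, d' x = d x + ((x == i) + (x == j))) ->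
  realizes eG d -> realizes eH d' -> exists2 e, realizes e d & ~~ e i j.
Proof.
move=> ij dd' Gd Hd'.
have [Gij|] := boolP (eG i j); last by exists eG.
have del_H (e : rel V) : realizes e d' -> e i j -> exists2 e, realizes e d & ~~ e i j.
  move=> [es ed] eij; exists (del_edge e i j); last by rewrite /del_edge !eqxx andbF.
  split; first exact: del_edge_simple.
  by move=> x; have := degree_del_edge es x ij eij; rewrite ed dd'; lia.
have [Hij|nHij] := boolP (eH i j); first exact: del_H Hij.
have [GG Gdeg] := Gd; have [HH Hdeg] := Hd'.
have [Gs Gi] := GG; have [Hs Hi] := HH.
have : ~~ ([set y | eH i y] \subset [set y | eG i y]).
  apply/negP => /subset_leq_card.
  by rewrite -/(degree eH i) -/(degree eG i) Hdeg Gdeg dd' eqxx; lia.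
case/subsetPn => u; rewrite !inE => Hiu nGiu.
have iu : i != u := edge_neq HH Hiu.
have uj : u != j by apply: contraNneq nHij => <-.
have [/existsP[x /and3P[xj Gux nGjx]]|/existsPn noG] :=
  boolP [exists x, [&& x != j, eG u x & ~~ eG j x]].
  exists (switch eG i j u x).
    by apply: switch_realizes => //; rewrite eq_sym.
  apply: switch_removes => //; first by rewrite eq_sym.
  by apply: contraNneq nGiu => ->; rewrite Gs.
have [/existsP[x /and3P[xu Hjx nHux]]|/existsPn noH] :=
  boolP [exists x, [&& x != u, eH j x & ~~ eH u x]].
  apply: (del_H (switch eH i u j x)); last exact: switch_adds.
  by apply: switch_realizes => //; rewrite eq_sym.
exfalso.
have sG : [set y | eG u y] :\ j \subset [set y | eG j y] :\ i :\ u.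
  apply/subsetP => x; rewrite !inE => /andP[xj Gux].
  have := noG x; rewrite xj Gux negbK /= => ->; rewrite andbT.
  apply/andP; split; first by apply: contraTneq Gux => ->; rewrite Gi.
  by apply: contraTneq Gux => ->; rewrite Gs.
have sH : i |: ([set y | eH j y] :\ u) \subset [set y | eH u y] :\ j.
  apply/subsetP => x; rewrite !inE => /orP[/eqP->|/andP[xu Hjx]].
    by rewrite ij Hs.
  have := noH x; rewrite xu Hjx negbK /= => ->; rewrite andbT.
  by apply: contraTneq Hjx => ->; rewrite Hi.
have := subset_leq_card sG; have := subset_leq_card sH.
rewrite cardsU1 !inE [eH j i]Hs (negbTE nHij) andbF /=.
have := cardsD1 j [set y | eG u y]; have := cardsD1 i [set y | eG j y].
have := cardsD1 u ([set y | eG j y] :\ i); have := cardsD1 u [set y | eH j y].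
have := cardsD1 j [set y | eH u y].
rewrite -![#|[set y | _ _ y]|]/(degree _ _) !Hdeg !Gdeg !dd' !inE !eqxx /=.
rewrite [u == i]eq_sym (negbTE iu) (negbTE uj) [j == i]eq_sym (negbTE ij).
rewrite [eG j i]Gs Gij [eG j u]Gs [eH j u]Hs /=.
by clear; lia.
Qed.

(** * Disjoint vertex sets *)

Section DisjointSets.
Variable V : finType.
Implicit Types S T : {set V}.

Lemma disjointU1l S T x : [disjoint S & T] -> x \notin T -> [disjoint x |: S & T].
Proof. by rewrite !disjoints_subset subUset sub1set inE => -> ->. Qed.

Lemma disjointU1r S T x : [disjoint S & T] -> x \notin S -> [disjoint S & x |: T].
Proof. by rewrite ![[disjoint S & _]]disjoint_sym; apply: disjointU1l. Qed.

Lemma disjointD1l S T x : [disjoint S & T] -> [disjoint S :\ x & T].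
Proof. exact/disjointWl/subD1set. Qed.

Lemma disjointD1r S T x : [disjoint S & T] -> [disjoint S & T :\ x].
Proof. exact/disjointWr/subD1set. Qed.

Lemma card_disjointU S T : [disjoint S & T] -> #|S :|: T| = #|S| + #|T|.
Proof. by move=> dST; rewrite cardsU disjoint_setI0 // cards0 subn0. Qed.

Lemma card_disjoint_le S T : [disjoint S & T] -> #|S| + #|T| <= #|V|.
Proof.
move=> dST; rewrite -cardsT; apply: leq_trans (subset_leq_card (subsetT (S :|: T))).
by rewrite card_disjointU.
Qed.

Lemma card_disjoint_lt S T x :
  [disjoint S & T] -> x \notin S -> x \notin T -> #|S| + #|T| < #|V|.
Proof.
move=> dST xS xT; have := card_disjoint_le (disjointU1l dST xT).
by rewrite cardsU1 xS.
Qed.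

End DisjointSets.

(** * The gap of a pair (S, T): marginal costs, parity, nonnegativity, complementation *)

Definition gap (V : finType) (d : V -> nat) (S T : {set V}) : int :=
  (#|S|%:Z * (#|V|%:Z - 1 - #|T|%:Z) + (\sum_(x in T) d x)%:Z
   - (\sum_(x in S) d x)%:Z)%R.

Section Gap.
Variables (V : finType).
Implicit Types (d : V -> nat) (S T : {set V}).

Lemma gap_addl d S T x : x \notin S ->
  gap d (x |: S) T = (gap d S T + (#|V|%:Z - 1 - #|T|%:Z - (d x)%:Z))%R.
Proof. by move=> xS; rewrite /gap cardsU1 xS big_setU1 //=; lia. Qed.

Lemma gap_addr d S T x : x \notin T ->
  gap d S (x |: T) = (gap d S T + ((d x)%:Z - #|S|%:Z))%R.
Proof. by move=> xT; rewrite /gap cardsU1 xT big_setU1 //=; lia. Qed.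

Lemma gap_dell d S T x : x \in S ->
  gap d (S :\ x) T = (gap d S T - (#|V|%:Z - 1 - #|T|%:Z - (d x)%:Z))%R.
Proof.
by move=> xS; rewrite -{2}(setD1K xS) gap_addl ?setD11 //; lia.
Qed.

Lemma gap_delr d S T x : x \in T ->
  gap d S (T :\ x) = (gap d S T - ((d x)%:Z - #|S|%:Z))%R.
Proof.
by move=> xT; rewrite -{2}(setD1K xT) gap_addr ?setD11 //; lia.
Qed.

Lemma sum_indicator (A : {set V}) (a : V) : \sum_(x in A) (x == a) = (a \in A) :> nat.
Proof.
have [aA|aA] := boolP (a \in A).
  by rewrite (bigD1 a) //= eqxx big1 // => x /andP[_ /negbTE->].
by rewrite big1 // => x xA; rewrite (negbTE (memPn aA x xA)).
Qed.

Lemma sum_indicatorT (a : V) : \sum_x (x == a) = 1 :> nat.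
Proof. by rewrite (bigD1 a) //= eqxx big1 // => x /negbTE->. Qed.

Lemma gap_bump d d' (i j : V) S T :
  (forall x, d' x = d x + ((x == i) + (x == j))) ->
  gap d' S T = (gap d S T + ((i \in T)%:Z + (j \in T)%:Z)
                - ((i \in S)%:Z + (j \in S)%:Z))%R.
Proof.
move=> dd'; rewrite /gap !(eq_bigr _ (fun x _ => dd' x)) !big_split /=.
by rewrite !sum_indicator; lia.
Qed.

(** With T the complement of S, the gap is |S|(|S| - 1) + sum_V d - 2 sum_S d, where every term is
    even. *)
Lemma gap_even d S T : [disjoint S & T] -> S :|: T = setT ->
  ~~ odd (\sum_x d x) -> exists m : int, gap d S T = (2 * m)%R.
Proof.
move=> dST ST; rewrite (eq_bigl [in [predU S & T]]) => [|x]; last first.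
  by have := in_setT x; rewrite -ST !inE.
rewrite bigU //= => ev.
have VE : #|S| + #|T| = #|V| by rewrite -cardsT -ST card_disjointU.
have := odd_double_half (\sum_(x in S) d x + \sum_(x in T) d x).
rewrite (negbTE ev) add0n; move: (half _) => q Eq.
rewrite /gap -VE; have := odd_double_half #|S|; move: (half _) => p; clear ev.
case: (odd _) => <-.
  exists ((p.*2 + 1)%:Z * p%:Z + q%:Z - (\sum_(x in S) d x)%:Z)%R.
  by move: Eq; clear; lia.
exists (p%:Z * (p.*2%:Z - 1) + q%:Z - (\sum_(x in S) d x)%:Z)%R.
by move: Eq; clear; lia.
Qed.

(** Split the degrees over S by neighbours inside and outside T. Edges from S into T number at most
    sum_T d; a vertex of S is outside T and not its own neighbour, so it has at most n - 1 - |T|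
    neighbours outside T. *)
Lemma gap_realizes_ge0 (e : rel V) d S T :
  realizes e d -> [disjoint S & T] -> (0 <= gap d S T)%R.
Proof.
move=> [[es ei] ed] dST.
have cST := card_disjoint_le dST.
suff : \sum_(x in S) d x <= \sum_(x in T) d x + #|S| * (#|V| - 1 - #|T|).
  rewrite /gap; have [->|] := posnP #|S|; first by rewrite mul0n mul0r; lia.
  move=> S0; have : ((#|V| - 1 - #|T|)%N%:Z = #|V|%:Z - 1 - #|T|%:Z)%R by lia.
  by move=> <-; lia.
have dE x : d x = \sum_(y in T) e x y + \sum_(y in ~: T) e x y.
  rewrite -ed /degree -sum1_card big_mkcond (bigID (mem T)) /=.
  congr (_ + _); first by apply: eq_bigr => y _; rewrite inE; case: (e x y).
  by apply: eq_big => y; rewrite !inE //; case: (e x y).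
rewrite (eq_bigr _ (fun x _ => dE x)) big_split /=; apply: leq_add.
  rewrite exchange_big /=; apply: leq_sum => y yT.
  rewrite -ed /degree -sum1_card [leqRHS]big_mkcond [leqLHS]big_mkcond /=.
  by apply: leq_sum => x _; rewrite inE [e x y]es; case: (x \in S); case: (e y x).
rewrite -sum_nat_const; apply: leq_sum => x xS.
have xT : x \in ~: T by rewrite inE (disjointFr dST).
rewrite (bigD1 x) //= ei add0n.
apply: (@leq_trans #|~: T :\ x|).
  rewrite -sum1_card [leqRHS](eq_bigl (fun y => (y \in ~: T) && (y != x))).
    by apply: leq_sum => y _; case: (e x y).
  by move=> y; rewrite !inE andbC.
have := cardsC T; have := cardsD1 x (~: T); rewrite xT => -> <-.
by clear; lia_card.
Qed.

(** Handshake lemma: with vertices ordered by [enum_rank], each edge is counted once from each end,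
    and the two counts agree by symmetry. *)
Lemma sum_degree_even (e : rel V) d : realizes e d -> ~~ odd (\sum_x d x).
Proof.
move=> [[es ei] ed].
pose lt (x y : V) := enum_rank x < enum_rank y.
have -> : \sum_x d x = \sum_x \sum_(y | lt x y) e x y + \sum_x \sum_(y | lt y x) e x y.
  rewrite -big_split /=; apply: eq_bigr => x _.
  rewrite -ed /degree -sum1_card big_mkcond (bigID (lt x)) /=; congr (_ + _).
    by apply: eq_bigr => y _; rewrite inE; case: (e x y).
  rewrite [RHS]big_mkcond [LHS]big_mkcond /=; apply: eq_bigr => y _; rewrite inE /lt.
  have [->|xy] := eqVneq x y; first by rewrite ltnn ei.
  have : (enum_rank x != enum_rank y :> nat) by rewrite (inj_eq val_inj) (inj_eq enum_rank_inj).
  by case: ltngtP => //=; case: (e x y).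
rewrite [X in _ + X](exchange_big_dep xpredT) //=.
under [X in _ + X]eq_bigr => x _ do under eq_bigr => y _ do rewrite es.
by rewrite addnn odd_double.
Qed.

Lemma realizes_degree_lt (e : rel V) d x : realizes e d -> d x < #|V|.
Proof.
move=> [[es ei] <-]; rewrite /degree -cardsT; apply: proper_card.
by rewrite properT; apply/negP => /eqP/setP/(_ x); rewrite !inE ei.
Qed.

Lemma compl_realizes (e : rel V) d :
  realizes e d -> realizes (compl_graph e) (fun x => #|V|.-1 - d x).
Proof.
move=> [[es ei] ed]; split.
  split=> [x y|x]; rewrite /compl_graph ?eqxx //.
  by rewrite es eq_sym.
move=> x; rewrite -ed /degree.
have -> : [set y | compl_graph e x y] = ~: (x |: [set y | e x y]).
  by apply/setP=> y; rewrite !inE negb_or eq_sym.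
by rewrite cardsCs setCK cardsU1 inE ei; clear; lia.
Qed.

(** The terms |T|(n - 1) cancel, leaving |S|(n - 1) - |S||T| + sum_T d - sum_S d. The bound on [d]
    makes the truncated subtraction exact. *)
Lemma gap_compl d S T : (forall x, d x < #|V|) ->
  gap (fun x => #|V|.-1 - d x) T S = gap d S T.
Proof.
move=> dV; have sumC (A : {set V}) : ((\sum_(x in A) (#|V|.-1 - d x))%:Z
    = #|A|%:Z * (#|V|%:Z - 1) - (\sum_(x in A) d x)%:Z)%R.
  have [->|] := eqVneq A set0; first by rewrite !big_set0 cards0 mul0r.
  case/set0Pn => x0 _; have := dV x0.
  suff : \sum_(x in A) (#|V|.-1 - d x) + \sum_(x in A) d x = #|A| * #|V|.-1.
    by case: (#|V|) => //= m; clear; lia.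
  rewrite -big_split -sum_nat_const; apply: eq_bigr => x _ /=.
  by rewrite subnK // -ltnS (ltn_predK (dV x)).
by rewrite /gap !sumC; clear; lia.
Qed.

End Gap.

(** * Erdos-Gallai theorem: even sum and nonnegative gaps give a realization *)

Section ErdosGallai.
Variable V : finType.
Implicit Types (d : V -> nat) (S T : {set V}).

Definition gap_ge0 d := forall S T, [disjoint S & T] -> (0 <= gap d S T)%R.

Lemma sum_le_max d S a : (forall x, d x <= d a) -> \sum_(x in S) d x <= #|S| * d a.
Proof. by move=> da; rewrite -sum_nat_const; apply: leq_sum. Qed.

Lemma term_le_sum d T a : a \in T -> d a <= \sum_(x in T) d x.
Proof. by move=> aT; rewrite (bigD1 a) //= leq_addr. Qed.

Lemma two_terms_le_sum d T a b : a \in T -> b \in T -> a != b -> d a + d b <= \sum_(x in T) d x.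
Proof.
move=> aT bT ab; rewrite (bigD1 a) //= leq_add2l (bigD1 b) /=; first by rewrite leq_addr.
by rewrite bT eq_sym.
Qed.

(** Passing to [d'] lowers the gap by one for each of [a], [b] in T and raises it by one for each in
    S. So only T meeting {a, b} matters, and there enough slack is found from the maximality of
    [d a] and from [d b > 0]. *)
Lemma gap_ge0_lower d d' a b : a != b -> gap_ge0 d -> ~~ odd (\sum_x d x) ->
  (forall x, d x <= d a) -> 0 < d b ->
  (forall x, d x = d' x + ((x == a) + (x == b))) -> gap_ge0 d'.
Proof.
move=> ab d0 ev da db dd' S T dST.
have := gap_bump S T dd'; have gST := d0 S T dST.
have sumS := sum_le_max S da.
(* If the cost n - 1 - |T'| - d a of adding [a] to S' is negative, nonnegativity after adding it
   forces a positive gap; otherwise the gap is at least [d b], because [d a] bounds all degrees in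
   S'. *)
have caseB S' T' : [disjoint S' & T'] -> a \notin S' -> a \notin T' -> b \in T' ->
    (0 < gap d S' T')%R.
  move=> dST' aS aT bT; have := d0 _ _ (disjointU1l dST' aT).
  rewrite gap_addl // => gA; have := d0 _ _ dST'; rewrite /gap in gA *.
  have := sum_le_max S' da; have := term_le_sum d bT; have := db; move: gA.
  by clear; nia.
have [aT|aT] := boolP (a \in T).
  have aS : a \notin S by rewrite (disjointFl dST).
  have [bT|bT] := boolP (b \in T).
    have bS : b \notin S by rewrite (disjointFl dST).
    rewrite (negbTE aS) (negbTE bS).
    suff : (1 < gap d S T)%R by clear; lia.
    have [daS|daS] := leqP (d a) #|S|; last first.
      have bTa : b \in T :\ a by rewrite !inE eq_sym ab.
      have := caseB S (T :\ a) (disjointD1r a dST) aS (negbT (setD11 _ _)) bTa.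
      by rewrite gap_delr //; move: daS; clear; lia.
    have cST := card_disjoint_le dST.
    have sT := two_terms_le_sum d aT bT ab.
    have [ST|] := eqVneq (S :|: T) setT; last first.
      rewrite -subTset => /subsetPn[x _]; rewrite inE negb_or => /andP[xS xT].
      have := card_disjoint_lt dST xS xT.
      by rewrite /gap; move: sumS sT db daS (da b); clear; nia.
    have [m gE] := gap_even dST ST ev.
    (* When |S| = d a the size estimates yield only a positive gap; parity raises it to 2. *)
    suff : (0 < gap d S T)%R by move: gE; clear; lia.
    by rewrite /gap; move: sumS sT db daS (da b) cST; clear; nia.
  have [bS|bS] := boolP (b \in S); first by rewrite (negbTE aS); move: gST; clear; lia.
  rewrite (negbTE aS).
  suff : (0 < gap d S T)%R by clear; lia.
  have daS : (0 < gap d S T)%R || (d a <= #|S|).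
    have := d0 _ _ (disjointD1r a dST); rewrite gap_delr //.
    by clear; lia.
  case/orP: daS => // daS.
  have := card_disjoint_lt dST bS bT; have := term_le_sum d aT.
  by rewrite /gap; move: sumS daS db (da b); clear; nia.
have [aS|aS] := boolP (a \in S).
  have [bT|bT] := boolP (b \in T); last by move: gST; clear; lia.
  by rewrite (disjointFl dST bT); move: gST; clear; lia.
have [bT|bT] := boolP (b \in T); last by move: gST; clear; lia.
have := caseB S T dST aS aT bT.
by rewrite (disjointFl dST bT); clear; lia.
Qed.

(* Havel-Hakimi style induction: realize d - e_a - e_b with d a maximal and d b
   minimal positive, then add the edge ab, after a switch if it is present. *)
Lemma gap_ge0_realizable d :
  ~~ odd (\sum_x d x) -> gap_ge0 d -> exists e, realizes e d.
Proof.
have [m] := ubnP (\sum_x d x); elim: m d => // m IH d; rewrite ltnS => dm ev d0.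
have [/forallP dz|] := boolP [forall x, d x == 0].
  exists (fun _ _ => false); split=> // x; rewrite (eqP (dz x)).
  by apply/eqP; rewrite cards_eq0; apply/eqP/setP => y; rewrite !inE.
case/forallPn => x0 dx0.
pose a := [arg max_(x > x0) d x].
have da x : d x <= d a by rewrite /a; case: arg_maxnP => // y _; apply.
have da0 : 0 < d a by apply: leq_trans (da x0); rewrite lt0n.
(* Otherwise S = {a} with T its complement has gap - d a < 0. *)
have [b0 b0P] : exists b, (b != a) && (0 < d b).
  apply/existsP; apply: contraT => /existsPn nob.
  have /d0 : [disjoint [set a] & ~: [set a]] by rewrite -setI_eq0 setICr.
  rewrite /gap cards1 big_set1 big1 => [|x]; last first.
    by rewrite !inE => xa; have := nob x; rewrite xa /= lt0n negbK => /eqP.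
  by have := cardsC1 a; move: da0 (max_card (pred1 a)); rewrite card1 => + + ->; clear; lia.
pose b := [arg min_(x < b0 | (x != a) && (0 < d x)) d x].
have [ba db bmin] : [/\ b != a, 0 < d b & forall x, x != a -> 0 < d x -> d b <= d x].
  rewrite /b; case: arg_minnP => // y /andP[ya dy] ymin; split=> // x xa dx.
  by apply: ymin; rewrite xa.
have ab : a != b by rewrite eq_sym.
pose d' x := d x - ((x == a) + (x == b)).
have dd' x : d x = d' x + ((x == a) + (x == b)).
  rewrite subnK //; have [->|xa] := eqVneq x a; first by rewrite (negbTE ab).
  by have [->|] := eqVneq x b.
have sumd : \sum_x d x = (\sum_x d' x).+2.
  rewrite (eq_bigr _ (fun x _ => dd' x)) !big_split /=.
  by rewrite !sum_indicatorT addn2.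
have [|||e' e'd'] := IH d'.
- by rewrite -ltnS -sumd ltnW.
- by move: ev; rewrite sumd /= negbK.
- exact: gap_ge0_lower ab d0 ev da db dd'.
suff [e [eG edeg] nab] : exists2 e, realizes e d' & ~~ e a b.
  exists (add_edge e a b); split; first exact: add_edge_simple.
  by move=> x; rewrite degree_add_edge // edeg -dd'.
have [e'ab|] := boolP (e' a b); last by exists e'.
have [e'G e'deg] := e'd'; have [e's e'i] := e'G.
(* Otherwise the n - 1 - |Z| vertices outside Z other than [a] are all among its d a - 1 neighbours
   in [e'], and the gap of ({a}, Z) is negative. *)
have [c /and3P[ca nac dc]] : exists c, [&& c != a, ~~ e' a c & 0 < d c].
  apply/existsP; apply: contraT => /existsPn noc.
  pose Z := [set x | (x != a) && (d x == 0)].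
  have /d0 : [disjoint [set a] & Z] by rewrite disjoints1 !inE eqxx.
  rewrite /gap cards1 big_set1 big1 => [|x]; last by rewrite inE => /andP[_ /eqP].
  have : ~: Z :\ a \subset [set y | e' a y].
    apply/subsetP => x; rewrite !inE => /andP[xa]; rewrite xa /= => dx.
    by have := noc x; rewrite xa lt0n dx andbT negbK.
  move/subset_leq_card; rewrite -/(degree e' a) e'deg /d' eqxx (negbTE ab).
  have := cardsC Z; have := cardsD1 a (~: Z); rewrite !inE eqxx /= => -> <-.
  by move: da0; clear; lia_card.
have bc : b != c by apply: contraNneq nac => <-.
(* In [e'], [c] has degree d c >= d b while [b] has degree d b - 1, so [c] has a neighbour, other
   than [b], that is not adjacent to [b]. *)
have : ~~ ([set y | e' c y] :\ b \subset [set y | e' b y] :\ c).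
  apply/negP => /subset_leq_card.
  have := cardsD1 b [set y | e' c y]; have := cardsD1 c [set y | e' b y].
  rewrite !inE [e' b c]e's -/(degree e' b) -/(degree e' c) !e'deg /d' !eqxx.
  have := bmin c ca dc; rewrite (negbTE ba) (negbTE ca) [c == b]eq_sym (negbTE bc).
  by move: db; clear; lia.
case/subsetPn => x; rewrite !inE => /andP[xb ecx]; rewrite negb_and negbK => nbx.
have {}nbx : ~~ e' b x.
  by case/orP: nbx => // /eqP xc; move: ecx; rewrite xc e'i.
exists (switch e' a b c x).
  by apply: switch_realizes => //; rewrite eq_sym.
apply: switch_removes => //.
by apply: contraNneq nac => ->; rewrite e's.
Qed.

End ErdosGallai.

(** * Forced pairs characterized by small gaps *)

Section ForcedPairs.
Variable V : finType.
Implicit Types (d : V -> nat) (S T : {set V}).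

(** The positions of [i] and [j] in which raising both degrees by one turns a small gap negative:
    the gap falls by two in the first case, by one in the others. *)
Definition forces_edge d i j S T :=
  [disjoint S & T] /\
  [\/ [/\ i \in S, j \in S & (gap d S T <= 1)%R],
      [/\ i \in S, j \notin S, j \notin T & (gap d S T <= 0)%R]
    | [/\ j \in S, i \notin S, i \notin T & (gap d S T <= 0)%R]].

Definition forces_nonedge d i j S T :=
  [disjoint S & T] /\
  [\/ [/\ i \in T, j \in T & (gap d S T <= 1)%R],
      [/\ i \in T, j \notin S, j \notin T & (gap d S T <= 0)%R]
    | [/\ j \in T, i \notin S, i \notin T & (gap d S T <= 0)%R]].

Lemma forced_edgeP d i j : i != j -> (exists e, realizes e d) ->
  (forall e, realizes e d -> e i j) <-> exists S T, forces_edge d i j S T.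
Proof.
move=> ij [e0 e0d]; pose d' x := d x + ((x == i) + (x == j)).
have dd' x : d' x = d x + ((x == i) + (x == j)) by [].
split=> [forced|[S [T [dST cert]]] e [eG edeg]].
  have [/forallP d'0|] :=
    boolP [forall S : {set V}, forall T : {set V}, [disjoint S & T] ==> (0 <= gap d' S T)%R].
    have [||e' e'd'] := @gap_ge0_realizable V d'.
    - rewrite !big_split /= !oddD.
      by rewrite !sum_indicatorT /= addbF; apply: sum_degree_even e0d.
    - by move=> S T dST; have /forallP/(_ T)/implyP := d'0 S; apply.
    have [e ed] := avoiding_realization ij dd' e0d e'd'.
    by rewrite forced.
  case/forallPn => S /forallPn[T]; rewrite negb_imply => /andP[dST].
  have g0 := gap_realizes_ge0 e0d dST; rewrite (gap_bump S T dd') => gN.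
  exists S, T; split=> //; move: g0 gN.
  have [iS|iS] := boolP (i \in S); have [jS|jS] := boolP (j \in S).
  - by rewrite (disjointFr dST iS) (disjointFr dST jS); constructor 1; split=> //; lia.
  - rewrite (disjointFr dST iS); have [jT|jT] := boolP (j \in T); first by lia.
    by constructor 2; split=> //; lia.
  - rewrite (disjointFr dST jS); have [iT|iT] := boolP (i \in T); first by lia.
    by constructor 3; split=> //; lia.
  - by lia.
(* Adding [ij] to a realization that lacks it would realize [d'], which has a negative gap. *)
apply: contraT => nij.
have e'd' : realizes (add_edge e i j) d'.
  split; first exact: add_edge_simple.
  by move=> x; rewrite degree_add_edge // edeg.
have := gap_realizes_ge0 e'd' dST; rewrite (gap_bump S T dd').
case: cert => [[iS jS]|[iS jS jT]|[jS iS iT]].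
- by rewrite iS jS (disjointFr dST iS) (disjointFr dST jS); clear; lia.
- by rewrite iS (negbTE jS) (disjointFr dST iS) (negbTE jT); clear; lia.
- by rewrite jS (negbTE iS) (disjointFr dST jS) (negbTE iT); clear; lia.
Qed.

Lemma eq_realizes (e : rel V) d d' : d =1 d' -> realizes e d -> realizes e d'.
Proof. by move=> dd' [eG ed]; split=> // x; rewrite -dd'. Qed.

Lemma forced_nonedgeP d i j : i != j -> (exists e, realizes e d) ->
  (forall e, realizes e d -> ~~ e i j) <-> exists S T, forces_nonedge d i j S T.
Proof.
move=> ij [e0 e0d]; have dV x := realizes_degree_lt x e0d.
pose c x := #|V|.-1 - d x.
have cc x : #|V|.-1 - c x = d x by rewrite subKn // -ltnS (ltn_predK (dV x)).
have eC : exists e, realizes e c by exists (compl_graph e0); apply: compl_realizes.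
have forcedC : (forall e, realizes e d -> ~~ e i j) <-> (forall e, realizes e c -> e i j).
  split=> forced e er.
    have := forced _ (eq_realizes cc (compl_realizes er)).
    by rewrite /compl_graph ij negbK.
  by have := forced _ (compl_realizes er); rewrite /compl_graph ij.
have certC S T : forces_nonedge d i j S T <-> forces_edge c i j T S.
  rewrite /forces_nonedge /forces_edge (gap_compl _ _ dV) disjoint_sym.
  by split=> -[dST [[? ? ?]|[? ? ? ?]|[? ? ? ?]]]; split=> //;
    [constructor 1|constructor 2|constructor 3|constructor 1|constructor 2|constructor 3].
rewrite forcedC (forced_edgeP ij eC).
by split=> -[S [T /certC H]]; exists T, S.
Qed.

End ForcedPairs.

(** * Initial segments and the Erdos-Gallai differences *)

Definition edge_condition n (d : n.-tuple nat) (i j : 'I_n) :=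
  exists k : nat, 1 <= k <= n /\
    (((EG_diff d k <= 1)%R /\ j.+1 <= k) \/
     (EG_diff d k = 0%R /\ i.+1 <= k < j.+1 /\ k <= tnth d j)).

Definition nonedge_condition n (d : n.-tuple nat) (i j : 'I_n) :=
  exists k : nat, 0 <= k <= n /\
    (((EG_diff d k <= 1)%R /\ tnth d i <= k < i.+1) \/
     (EG_diff d k = 0%R /\ k < i.+1 /\ tnth d j <= k <= tnth d i)).

(** Subtraction truncates at k = 0, where the factor k vanishes anyway. *)
Lemma mulz_pred k : (k%:Z * (k - 1)%N%:Z = k%:Z * (k%:Z - 1))%R.
Proof. by case: k => [|k]; [rewrite !mul0r | congr (_ * _)%R; lia]. Qed.

Section Order.
Variable n : nat.
Implicit Types (d : n.-tuple nat) (S T : {set 'I_n}).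

Lemma card_initial k : k <= n -> #|[set x : 'I_n | x < k]| = k.
Proof.
move=> kn; rewrite -sum1_card (eq_bigl (fun x : 'I_n => x < k)) => [|x]; last by rewrite inE.
by rewrite -(big_ord_widen _ (fun _ => 1) kn) sum1_card card_ord.
Qed.

Lemma card_le_order S : #|S| <= n.
Proof. by rewrite -[leqRHS]card_ord max_card. Qed.

Lemma disjoint_initial k T : (forall x : 'I_n, x \in T -> k <= x) ->
  [disjoint [set x : 'I_n | x < k] & T].
Proof.
move=> Tk; rewrite disjoint_subset; apply/subsetP => x; rewrite !inE => xk.
by apply/negP => /Tk; rewrite leqNgt xk.
Qed.

Lemma initial_escape S (x : 'I_n) : x \in S -> #|S| <= x ->
  exists2 l : 'I_n, l < #|S| & l \notin S.
Proof.
move=> xS Sx; have : ~~ ([set x : 'I_n | x < #|S|] \subset S).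
  apply: contraL xS => sub; have := card_initial (card_le_order S) => cK.
  have /eqP <- : [set x : 'I_n | x < #|S|] == S by rewrite eqEcard sub cK leqnn.
  by rewrite inE -leqNgt.
by case/subsetPn => l; rewrite inE => lS nlS; exists l.
Qed.

Lemma final_escape S (x : 'I_n) : x \notin S -> x < #|S| ->
  exists2 l : 'I_n, #|S| <= l & l \in S.
Proof.
move=> xS Sx; have : ~~ (S \subset [set x : 'I_n | x < #|S|]).
  apply: contra xS => sub; have := card_initial (card_le_order S) => cK.
  have /eqP -> : S == [set x : 'I_n | x < #|S|] by rewrite eqEcard sub cK leqnn.
  by rewrite inE.
by case/subsetPn => l lS; rewrite inE -leqNgt => nlS; exists l.
Qed.

Lemma sum_le_initial (f : 'I_n -> nat) S :
  (forall x y : 'I_n, x <= y -> f y <= f x) ->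
  \sum_(x in S) f x <= \sum_(x < n | x < #|S|) f x.
Proof.
move=> fanti; pose K := [set x : 'I_n | x < #|S|].
have cK : #|K| = #|S| := card_initial (card_le_order S).
rewrite [leqRHS](eq_bigl [in K]) => [|x]; last by rewrite inE.
rewrite (big_setID K) [leqRHS](big_setID S) /= setIC leq_add2l.
have cD : #|S :\: K| = #|K :\: S| by rewrite !cardsD setIC cK.
(* [c] separates the two differences: values on S \ K are at most [c], and values on K \ S, at
   earlier positions, are at least [c]. *)
pose c := \max_(y in S :\: K) f y.
apply: (@leq_trans (#|S :\: K| * c)).
  by rewrite -sum_nat_const; apply: leq_sum => x xD; apply: leq_bigmax_cond.
rewrite cD -sum_nat_const; apply: leq_sum => x.
rewrite !inE => /andP[_ xS]; apply/bigmax_leqP => y.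
by rewrite !inE -leqNgt => /andP[yS _]; apply: fanti; lia.
Qed.

Lemma tnth_antitone d : sorted geq d ->
  forall x y : 'I_n, x <= y -> tnth d y <= tnth d x.
Proof.
move=> ds x y xy; rewrite !(tnth_nth 0).
have gt : transitive geq by move=> a b c; rewrite /geq /= => ab bc; apply: leq_trans bc ab.
by apply: (sorted_leq_nth gt leqnn 0 ds); rewrite ?inE ?size_tuple.
Qed.

(** With m = min(k, d), Delta_k is k(k - 1) + sum_V m minus the sum of m + d over the first k
    positions. Since m + d is nonincreasing, summing over S instead cannot lower the result; outside
    S, m is at most d on T and at most k elsewhere. *)
Lemma EG_diff_le_gap d S T : sorted geq d -> [disjoint S & T] ->
  (EG_diff d #|S| <= gap (tnth d) S T)%R.
Proof.
move=> ds dST; set k := #|S|; pose m x := minn k (tnth d x).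
have anti := tnth_antitone ds.
have H1 : \sum_(x in S) (m x + tnth d x) <= \sum_(x < n | x < k) (m x + tnth d x).
  apply: sum_le_initial => x y xy; apply: leq_add; last exact: anti.
  by have := anti x y xy; rewrite /m; lia.
have H2 : \sum_(x < n | x < k) m x + \sum_(x < n | k < x.+1) m x
          = \sum_(x in S) m x + \sum_(x in ~: S) m x.
  transitivity (\sum_x m x).
    rewrite [RHS](bigID (fun x : 'I_n => x < k)) /=; congr (_ + _).
    by apply: eq_bigl => x; rewrite ltnS leqNgt.
  by rewrite (bigID [in S]) /=; congr (_ + _); apply: eq_bigl => x; rewrite inE.
have H3 : \sum_(x in ~: S) m x <= \sum_(x in T) tnth d x + #|~: (S :|: T)| * k.
  rewrite (bigID [in T]) /= -sum_nat_const; apply: leq_add.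
    rewrite (eq_bigl [in T]) => [|x]; first by apply: leq_sum => x _; apply: geq_minr.
    by rewrite inE; case: (boolP (x \in T)) => [/(disjointFl dST)->|]; rewrite ?andbF.
  rewrite [leqLHS](eq_bigl [in ~: (S :|: T)]) => [|x]; last by rewrite !inE negb_or.
  by apply: leq_sum => x _; apply: geq_minl.
have cR : k + #|T| + #|~: (S :|: T)| = n.
  by rewrite -[RHS]card_ord -(cardsC (S :|: T)) card_disjointU.
have kcR : (k%:Z * n%:Z = k%:Z * (k + #|T| + #|~: (S :|: T)|)%N%:Z)%R by rewrite cR.
move: H1 H2 H3; rewrite !big_split /= /EG_diff /EG_RHS /EG_LHS /gap -/k card_ord.
rewrite -[\sum_(l < n | k < l.+1) minn k (tnth d l)]/(\sum_(l < n | k < l.+1) m l).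
rewrite PoszD PoszM mulz_pred; move: kcR; clear.
move: (\sum_(l < n | k < l.+1) m l) (\sum_(x < n | x < k) m x) (\sum_(x in S) m x).
move: (\sum_(x in ~: S) m x) (\sum_(x < n | x < k) tnth d x) (\sum_(x in S) tnth d x).
move: (\sum_(x in T) tnth d x) #|_ (~: _)| #|_ T|.
by move: (k); clear; lia.
Qed.

(** Such a T attains the minimum min(k, d) at every later position. Positions of degree exactly k
    may lie in T or not, a freedom that the non-edge conditions use. *)
Lemma gap_initial_eq d T k : k <= n ->
  (forall x, x \in T -> k <= x /\ tnth d x <= k) ->
  (forall x : 'I_n, k <= x -> tnth d x < k -> x \in T) ->
  gap (tnth d) [set x : 'I_n | x < k] T = EG_diff d k.
Proof.
move=> kn Tle leT; set S := [set _ | _].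
have dST : [disjoint S & T] by apply: disjoint_initial => x /Tle[].
have cS : #|S| = k := card_initial kn.
have cR : k + #|T| + #|~: (S :|: T)| = n.
  by rewrite -[RHS]card_ord -(cardsC (S :|: T)) card_disjointU // cS.
have kcR : (k%:Z * n%:Z = k%:Z * (k + #|T| + #|~: (S :|: T)|)%N%:Z)%R by rewrite cR.
have HL : \sum_(x < n | x.+1 <= k) tnth d x = \sum_(x in S) tnth d x.
  by apply: eq_bigl => x; rewrite inE.
have HR : \sum_(x < n | k < x.+1) minn k (tnth d x)
          = \sum_(x in T) tnth d x + #|~: (S :|: T)| * k.
  rewrite (bigID [in T]) /= -sum_nat_const; congr (_ + _).
    rewrite (eq_bigl [in T]) => [|x]; first by apply: eq_bigr => x /Tle[_ /minn_idPr].
    by rewrite ltnS; case: (boolP (x \in T)) => [/Tle[->]|]; rewrite ?andbF.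
  apply: eq_big => [x|x]; first by rewrite !inE negb_or ltnS leqNgt.
  rewrite ltnS => /andP[kx xT]; apply/minn_idPl; rewrite leqNgt.
  by apply: contra xT; apply: leT.
rewrite /EG_diff /EG_RHS /EG_LHS /gap HL HR cS card_ord PoszD PoszM mulz_pred; move: kcR.
by clear; lia_card.
Qed.

(** * Moving a certificate (S, T) to an initial segment *)

Section Forced.
Variables (d : n.-tuple nat) (i j : 'I_n).
Hypotheses (ds : sorted geq d) (ij : i < j) (dG : graphic d).
Let f := tnth d.

Let anti : forall x y : 'I_n, x <= y -> f y <= f x := tnth_antitone ds.

Let inej : i != j.
Proof. by apply: contraTneq ij => ->; rewrite ltnn. Qed.

Let gap0 S T : [disjoint S & T] -> (0 <= gap f S T)%R.
Proof. by case: dG => e; apply: gap_realizes_ge0. Qed.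

Let gap_covering S T : [disjoint S & T] -> #|S| + #|T| = n ->
  (gap f S T <= 1)%R -> (gap f S T <= 0)%R.
Proof.
move=> dST cST; have ST : S :|: T = setT.
  by apply/eqP; rewrite eqEcard subsetT cardsT card_ord card_disjointU // cST leqnn.
case: dG => e /sum_degree_even ev.
by have [m ->] := gap_even dST ST ev; clear; lia_card.
Qed.

Lemma EG_diff_ge0 k : k <= n -> (0 <= EG_diff d k)%R.
Proof.
move=> kn; rewrite -(@gap_initial_eq d [set x : 'I_n | (k <= x) && (f x < k)]) //.
- by apply/gap0/disjoint_initial => x; rewrite inE => /andP[].
- by move=> x; rewrite inE => /andP[-> /ltnW].
- by move=> x kx fx; rewrite inE kx.
Qed.

(** The gap is minimal, so adding [j] to T cannot lower it, giving |S| <= d_j, and removing [i] from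
    S cannot either, so [i] has cost at most 0 in S. An earlier [l] missing from S has degree at
    least d_i, hence can leave T or join S without raising the gap. *)
Lemma edge_condition_tight S T : [disjoint S & T] ->
  i \in S -> j \notin S -> j \notin T -> (gap f S T <= 0)%R -> edge_condition d i j.
Proof.
have [m] := ubnP (#|~: S| + #|T|); elim: m S T => // m IH S T; rewrite ltnS => mST.
move=> dST iS jS jT g0; have iT := disjointFr dST iS.
have kn := card_le_order S; have k0 : 0 < #|S| by apply/card_gt0P; exists i.
have dk := le_trans (EG_diff_le_gap ds dST) g0.
have kdj : #|S| <= f j.
  by have := gap0 (disjointU1r dST jS); rewrite gap_addr //; move: g0; clear; lia_card.
have [iltk|kle] := ltnP i #|S|.
  exists #|S|; rewrite k0 kn; split=> //.
  have [jltk|kj] := ltnP j #|S|; first by left; move: dk; clear; lia_card.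
  right; have := EG_diff_ge0 kn; rewrite iltk /= -/(f j) kdj ltnS kj.
  by split=> //; apply/eqP; rewrite eq_le dk.
have [l lk lS] := initial_escape iS kle.
have fil : f i <= f l by apply: anti; lia_card.
have fji : f j <= f i by apply: anti; lia_card.
have jl : j != l by apply/eqP => jl; move: ij kle lk; rewrite jl; clear; lia_card.
have [lT|lT] := boolP (l \in T).
  apply: (IH S (T :\ l)) => //.
  - by move: mST; rewrite (cardsD1 l T) lT; clear; lia_card.
  - exact: disjointD1r.
  - by rewrite !inE negb_and jT orbT.
  - by rewrite gap_delr //; move: g0 fil fji kdj; clear; lia_card.
apply: (IH (l |: S) T) => //.
- by move: mST; rewrite setCU setIC -setDE (cardsD1 l (~: S)) !inE lS; clear; lia_card.
- exact: disjointU1l.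
- by rewrite !inE iS orbT.
- by rewrite !inE negb_or jl.
- have := gap0 (disjointD1l i dST); rewrite gap_dell // gap_addl //.
  by move: g0 fil; clear; lia_card.
Qed.

(** Similar moves, with an exit: once removing [j] from S brings the gap to 0 or less, the tight
    case applies. *)
Lemma edge_condition_pair S T : [disjoint S & T] ->
  i \in S -> j \in S -> (gap f S T <= 1)%R -> edge_condition d i j.
Proof.
have [m] := ubnP (#|~: S| + #|T|); elim: m S T => // m IH S T; rewrite ltnS => mST.
move=> dST iS jS g1; have jT := disjointFr dST jS.
have kn := card_le_order S; have k0 : 0 < #|S| by apply/card_gt0P; exists i.
have dk := le_trans (EG_diff_le_gap ds dST) g1.
have [jltk|kle] := ltnP j #|S|; first by exists #|S|; rewrite k0 kn; split=> //; left.
have [l lk lS] := initial_escape jS kle.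
have fjl : f j <= f l by apply: anti; lia_card.
have tight : (gap f (S :\ j) T <= 0)%R -> edge_condition d i j.
  apply: edge_condition_tight; rewrite ?setD11 ?jT //; first exact: disjointD1l.
  by rewrite !inE inej.
have grow : #|~: (l |: S)| < #|~: S|.
  by rewrite setCU setIC -setDE (cardsD1 l (~: S)) !inE lS; clear; lia_card.
have [lT|lT] := boolP (l \in T).
  have [kfl|flk] := leqP #|S| (f l).
    apply: (IH S (T :\ l)) => //.
    - by move: mST; rewrite (cardsD1 l T) lT; clear; lia_card.
    - exact: disjointD1r.
    - by rewrite gap_delr //; move: g1 kfl; clear; lia_card.
  apply: tight; rewrite gap_dell // card_ord.
  (* [j] has cost at least 1 in S unless S and T cover all vertices; then the cost may be 0, but
     parity already makes the gap at most 0. *)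
  have := card_disjoint_le dST; rewrite card_ord leq_eqVlt => /orP[/eqP cST|].
    by have := gap_covering dST cST g1; move: cST fjl flk; clear; lia_card.
  by move: g1 fjl flk; clear; lia_card.
have [fj|fj] := leqP (#|T| + f j + 1) (n.-1); last first.
  apply: (IH (l |: S) T) => //.
  - by move: mST grow; clear; lia_card.
  - exact: disjointU1l.
  - by rewrite !inE iS orbT.
  - by rewrite !inE jS orbT.
  - by rewrite gap_addl // card_ord; move: g1 fj fjl (ltn_ord i); clear; lia_card.
by apply: tight; rewrite gap_dell // card_ord; move: g1 fj; clear; lia_card.
Qed.

Lemma edge_condition_of S T : forces_edge f i j S T -> edge_condition d i j.
Proof.
case=> dST [[]|[]|[jS iS iT g0]]; [exact: edge_condition_pair|exact: edge_condition_tight|].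
have jT := disjointFr dST jS.
(* Exchanging [j] for [i] in S does not raise the gap, as d_i >= d_j. *)
apply: (@edge_condition_tight (i |: (S :\ j)) T).
- by apply: disjointU1l => //; apply: disjointD1l.
- by rewrite !inE eqxx.
- by rewrite !inE [j == i]eq_sym (negbTE inej) eqxx.
- by rewrite jT.
rewrite gap_addl ?gap_dell //; last by rewrite !inE negb_and iS orbT.
by move: g0 (anti (ltnW ij)); clear; lia_card.
Qed.

Lemma nonedge_condition_tight S T : [disjoint S & T] ->
  j \in T -> i \notin S -> i \notin T -> (gap f S T <= 0)%R -> nonedge_condition d i j.
Proof.
have [m] := ubnP #|S|; elim: m S => // m IH S; rewrite ltnS => mS.
move=> dST jT iS iT g0; have jS := disjointFl dST jT.
have kn := card_le_order S; have dk := le_trans (EG_diff_le_gap ds dST) g0.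
have dk0 : EG_diff d #|S| = 0%R by apply/eqP; rewrite eq_le dk EG_diff_ge0.
have djk : f j <= #|S|.
  by have := gap0 (disjointD1r j dST); rewrite gap_delr //; move: g0; clear; lia_card.
have [ki|ik] := leqP #|S| i.
  exists #|S|; split; rewrite ?kn // dk0 ltnS ki andbT -/(f i) -/(f j) djk.
  by have [kfi|/ltnW fik] := leqP #|S| (f i); [right|left].
have [l kl lS] := final_escape iS ik.
have fli : f l <= f i by apply: anti; lia_card.
apply: (IH (S :\ l)) => //.
- by move: mS; rewrite (cardsD1 l S) lS.
- exact: disjointD1l.
- by rewrite !inE negb_and iS orbT.
have := gap0 (disjointU1l dST iT); rewrite gap_addl // gap_dell //.
by move: g0 fli; clear; lia_card.
Qed.

Lemma nonedge_condition_pair S T : [disjoint S & T] ->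
  i \in T -> j \in T -> (gap f S T <= 1)%R -> nonedge_condition d i j.
Proof.
have [m] := ubnP #|S|; elim: m S => // m IH S; rewrite ltnS => mS.
move=> dST iT jT g1; have iS := disjointFl dST iT.
have kn := card_le_order S; have dk := le_trans (EG_diff_le_gap ds dST) g1.
have tight : (gap f S (T :\ i) <= 0)%R -> nonedge_condition d i j.
  apply: nonedge_condition_tight; rewrite ?setD11 ?iS //; first exact: disjointD1r.
  by rewrite !inE eq_sym inej.
have [fik|kfi] := leqP (f i) #|S|; last first.
  by apply: tight; rewrite gap_delr //; move: g1 kfi; clear; lia_card.
have [ki|ik] := leqP #|S| i; first by exists #|S|; split; rewrite ?kn //; left; rewrite fik.
have [l kl lS] := final_escape (negbT iS) ik.
have fli : f l <= f i by apply: anti; lia_card.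
have cST := card_disjoint_le dST; rewrite card_ord in cST.
have [cov|ncov] := leqP (#|T| + f l + 1) n.
  apply: (IH (S :\ l)) => //.
  - by move: mS; rewrite (cardsD1 l S) lS.
  - exact: disjointD1l.
  - by rewrite gap_dell // card_ord; move: g1 cov; clear; lia_card.
(* Now n <= |T| + d_l <= |T| + d_i <= |T| + |S| <= n, so S and T cover all vertices and d_i = |S|:
   the gap is at most 0 by parity, and removing [i] from T leaves it unchanged. *)
have : (gap f S T <= 0)%R by apply: gap_covering => //; lia_card.
by move=> g0; apply: tight; rewrite gap_delr //; move: g0 fli fik ncov cST; clear; lia_card.
Qed.

Lemma nonedge_condition_of S T : forces_nonedge f i j S T -> nonedge_condition d i j.
Proof.
case=> dST [[]|[iT jS jT g0]|[]]; [exact: nonedge_condition_pair| |exact: nonedge_condition_tight].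
have iS := disjointFl dST iT.
apply: (@nonedge_condition_tight S (j |: (T :\ i))).
- by apply: disjointU1r => //; apply: disjointD1r.
- by rewrite !inE eqxx.
- by rewrite iS.
- by rewrite !inE (negbTE inej) eqxx.
rewrite gap_addr ?gap_delr //; last by rewrite !inE negb_and jT orbT.
by move: g0 (anti (ltnW ij)); clear; lia_card.
Qed.

End Forced.

End Order.

(* The forced non-edge half differs from the printed text in two places, where
   the printed text is refutable: k = 0 is allowed, since otherwise
   d = (0, 0) with {i, j} = {1, 2} is a counterexample; and the first
   alternative reads d_i <= k < i instead of d_i < k < i, since otherwise
   d = (4, 2, 2, 2, 1, 1) with {i, j} = {5, 6} is one. *)
Theorem theorem2p3 (n : nat) (d : n.-tuple nat) (i j : 'I_n)
    (hgraphic : graphic d) (hsorted : sorted geq d) (hij : i < j) :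
  (forced_edge d i j <->
     exists k : nat, 1 <= k <= n /\
       (((EG_diff d k <= 1)%R /\ j.+1 <= k) \/
        (EG_diff d k = 0%R /\ i.+1 <= k < j.+1 /\ k <= tnth d j)))
  /\
  (forced_nonedge d i j <->
     exists k : nat, 0 <= k <= n /\
       (((EG_diff d k <= 1)%R /\ tnth d i <= k < i.+1) \/
        (EG_diff d k = 0%R /\ k < i.+1 /\ tnth d j <= k <= tnth d i))).
Proof.
have inej : i != j by apply: contraTneq hij => ->; rewrite ltnn.
split.
  apply: (iff_trans (forced_edgeP inej hgraphic)); split.
    by case=> S [T]; apply: edge_condition_of.
  case=> k [/andP[k0 kn] H]; pose T := [set x : 'I_n | (k <= x) && (tnth d x < k)].
  have Tle x : x \in T -> k <= x /\ tnth d x <= k by rewrite inE => /andP[-> /ltnW].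
  have leT (x : 'I_n) : k <= x -> tnth d x < k -> x \in T by rewrite inE => -> ->.
  exists [set x : 'I_n | x < k], T; split; first by apply: disjoint_initial => x /Tle[].
  rewrite (gap_initial_eq kn Tle leT) !inE.
  case: H => [[g1 jk]|[g0 [/andP[ik kj] kdj]]].
    by constructor 1; split=> //; apply: ltn_trans hij jk.
  by constructor 2; rewrite g0 -leqNgt negb_and -leqNgt kdj orbT; split.
apply: (iff_trans (forced_nonedgeP inej hgraphic)); split.
  by case=> S [T]; apply: nonedge_condition_of.
case=> k [/andP[_ kn] [[g1 /andP[fik ki]]|[g0 [ki /andP[fjk kfi]]]]].
  (* Degree exactly k is included so that [i] and [j] lie in T even when d_i = k. *)
  pose T := [set x : 'I_n | (k <= x) && (tnth d x <= k)].
  have Tle x : x \in T -> k <= x /\ tnth d x <= k by rewrite inE => /andP[].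
  have leT (x : 'I_n) : k <= x -> tnth d x < k -> x \in T by rewrite inE => -> /ltnW.
  exists [set x : 'I_n | x < k], T; split; first by apply: disjoint_initial => x /Tle[].
  rewrite (gap_initial_eq kn Tle leT) !inE; constructor 1.
  have := tnth_antitone hsorted (ltnW hij); split=> //; lia_card.
(* [j] is added in case d_j = k, while d_i >= k keeps [i] out. *)
pose T := j |: [set x : 'I_n | (k <= x) && (tnth d x < k)].
have Tle x : x \in T -> k <= x /\ tnth d x <= k.
  rewrite !inE => /orP[/eqP->|/andP[-> /ltnW //]]; split=> //.
  by rewrite -ltnS (leq_trans ki) // ltnW.
have leT (x : 'I_n) : k <= x -> tnth d x < k -> x \in T by rewrite !inE => -> ->; rewrite orbT.
exists [set x : 'I_n | x < k], T; split; first by apply: disjoint_initial => x /Tle[].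
rewrite (gap_initial_eq kn Tle leT) g0 !inE eqxx (negbTE inej) /= negb_and.
by constructor 3; rewrite -!leqNgt kfi orbT; split.
Qed.
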